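(* Let $d\ge1$, let $0=t_0<t_1<\dots<t_N=T$ and $\tau_n:=t_{n+1}-t_n$. Let $u^0,\dots,u^N$ be smooth $\mathbb{R}^d$-valued functions on $S^1$ which form a solution of the following temporally discrete scheme: for each $n\in\{0,\dots,N-1\}$ there are smooth functions $v^{n+1},w^{n+1}:S^1\to\mathbb{R}^d$ with $$\begin{aligned} 0&=\frac{u^{n+1}-u^n}{\tau_n}+v^{n+1}_x+w^{n+1},\\ 0&=v^{n+1}-\tfrac14\big(|u^n|^2+|u^{n+1}|^2\big)u^{n+1/2}-u^{n+1/2}_{xx},\\ 0&=w^{n+1}-|u^{n+1/2}|^2u^{n+1/2}_x+\big(u^{n+1/2}_x\cdot u^{n+1/2}\big)u^{n+1/2}, \end{aligned}$$ where $u^{n+1/2}:=\tfrac12(u^n+u^{n+1})$. Then $$F_4(u^n)=F_4(u^0)\quad\text{for all } n\in\{0,\dots,N\}.$$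
   Context: $S^1$ denotes the interval $[0,1]$ with matching endpoints (so functions on $S^1$ are $1$-periodic). $x\cdot y$ is the Euclidean inner product on $\mathbb{R}^d$ and $|\cdot|$ the induced norm. The subscript $x$ denotes differentiation in $x$. The energy functional is $F_4(u):=\int_{S^1}\big(\tfrac12|u_x|^2-\tfrac18|u|^4\big)\,dx$. *)

(* Defs.v *)
From HB Require Import structures.
From mathcomp Require Import all_boot all_order all_algebra.
From mathcomp Require Import all_classical all_reals all_analysis.
Set Implicit Arguments.
Unset Strict Implicit.
Unset Printing Implicit Defensive.
Import Order.TTheory GRing.Theory Num.Theory.
Import numFieldNormedType.Exports.
Local Open Scope ring_scope.
Local Open Scope classical_set_scope.

Definition dotp (R : realType) (d : nat) (x y : 'rV[R]_d) : R :=
  \sum_(i < d) x 0 i * y 0 i.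

(* The library's norm [`|x|] on ['rV[R]_d] is the sup norm, which is not the
   Euclidean one. *)
Definition enorm (R : realType) (d : nat) (x : 'rV[R]_d) : R :=
  Num.sqrt (dotp x x).

(* A smooth function on the circle [0,1]/(0 ~ 1) is represented by its
   1-periodic extension to the whole line. *)
Definition smooth_S1 (R : realType) (d : nat) (f : R -> 'rV[R]_d) : Prop :=
  periodic f 1 /\ forall (k : nat) (x : R), derivable f^`(k) x 1.

Definition F4 (R : realType) (d : nat) (u : R -> 'rV[R]_d) : R :=
  \int[lebesgue_measure]_(x in `[0, 1])
    (2^-1 * enorm (u^`()%classic x) ^+ 2 - 8^-1 * enorm (u x) ^+ 4).

Definition midpoint (R : realType) (d : nat) (a b : R -> 'rV[R]_d) :
  R -> 'rV[R]_d := fun x => 2^-1 *: (a x + b x).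

(* One step of the scheme, from [a] = u^n to [b] = u^(n+1) with time step
   [tau], where [v] and [w] are v^(n+1) and w^(n+1). *)
Definition scheme_step (R : realType) (d : nat) (tau : R)
    (a b v w : R -> 'rV[R]_d) : Prop :=
  let m := midpoint a b in
  forall x : R,
    [/\ 0 = tau^-1 *: (b x - a x) + v^`()%classic x + w x,
        0 = v x - (4^-1 * (enorm (a x) ^+ 2 + enorm (b x) ^+ 2)) *: m x
              - m^`(2)%classic x
      & 0 = w x - enorm (m x) ^+ 2 *: m^`()%classic x
              + dotp (m^`()%classic x) (m x) *: m x].

(* Main.v *)
(* Let [m] be the midpoint of two consecutive iterates [a] and [b].  Dotting the
   first equation with [v], the second with [b - a] and the third with [v] shows
   that the energy density of [b] minus that of [a] is the derivative of
     m' . (b - a) + tau/2 |v|^2 + tau/2 (|m|^2 |m'|^2 - (m . m')^2).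
   The last bracket appears because [w . m = 0], so that [w . v = w . m''].
   This function is 1-periodic, so its derivative has integral zero. *)

Require Import Defs.
From HB Require Import structures.
From mathcomp Require Import all_boot all_order all_algebra.
From mathcomp Require Import all_classical all_reals all_analysis.
From mathcomp Require Import ring.
Set Implicit Arguments.
Unset Strict Implicit.
Unset Printing Implicit Defensive.
Import Order.TTheory GRing.Theory Num.Theory.
Import numFieldNormedType.Exports.
Local Open Scope ring_scope.
Local Open Scope classical_set_scope.

Lemma dotpC (R : realType) (d : nat) (x y : 'rV[R]_d) : dotp x y = dotp y x.
Proof. by apply: eq_bigr => i _; rewrite mulrC. Qed.

Lemma dotpDl (R : realType) (d : nat) (x y z : 'rV[R]_d) :
  dotp (x + y) z = dotp x z + dotp y z.
Proof. by rewrite -big_split; apply: eq_bigr => i _; rewrite mxE mulrDl. Qed.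

Lemma dotpZl (R : realType) (d : nat) (k : R) (x y : 'rV[R]_d) :
  dotp (k *: x) y = k * dotp x y.
Proof. by rewrite mulr_sumr; apply: eq_bigr => i _; rewrite mxE mulrA. Qed.

Lemma dotpNl (R : realType) (d : nat) (x y : 'rV[R]_d) :
  dotp (- x) y = - dotp x y.
Proof. by rewrite -scaleN1r dotpZl mulN1r. Qed.

Lemma dotpDr (R : realType) (d : nat) (x y z : 'rV[R]_d) :
  dotp x (y + z) = dotp x y + dotp x z.
Proof. by rewrite dotpC dotpDl !(dotpC x). Qed.

Lemma dotpZr (R : realType) (d : nat) (k : R) (x y : 'rV[R]_d) :
  dotp x (k *: y) = k * dotp x y.
Proof. by rewrite dotpC dotpZl dotpC. Qed.

Lemma dotpNr (R : realType) (d : nat) (x y : 'rV[R]_d) :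
  dotp x (- y) = - dotp x y.
Proof. by rewrite dotpC dotpNl dotpC. Qed.

Definition dotpE := (dotpDl, dotpDr, dotpZl, dotpZr, dotpNl, dotpNr).

(** Only even powers of [enorm] occur in the energy and in the scheme, so its square root, not
    differentiable at the origin, can be eliminated everywhere. *)
Lemma sqr_enorm (R : realType) (d : nat) (x : 'rV[R]_d) :
  enorm x ^+ 2 = dotp x x.
Proof. by rewrite sqr_sqrtr// sumr_ge0// => i _; rewrite -expr2 sqr_ge0. Qed.

Lemma exprn4_enorm (R : realType) (d : nat) (x : 'rV[R]_d) :
  enorm x ^+ 4 = dotp x x ^+ 2.
Proof. by rewrite (exprM _ 2 2) sqr_enorm. Qed.

Lemma is_derive_row_coord (R : realType) (d : nat) (f : R -> 'rV[R]_d) (x : R)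
    (df : 'rV[R]_d) (i : 'I_d) :
  is_derive x 1 f df -> is_derive x 1 (fun y => f y 0 i) (df 0 i).
Proof.
move=> [f_derivable <-]; apply: DeriveDef; last by rewrite derive_mx// mxE.
by have /derivable_mxP := f_derivable.
Qed.

Lemma is_derive_dotp (R : realType) (d : nat) (f g : R -> 'rV[R]_d) (x : R)
    (df dg : 'rV[R]_d) :
  is_derive x 1 f df -> is_derive x 1 g dg ->
  is_derive x 1 (fun y => dotp (f y) (g y)) (dotp df (g x) + dotp (f x) dg).
Proof.
move=> f_df g_dg.
(* A sum of products of functions, rather than a function of sums, is the form that [is_derive_sum]
   and [is_deriveM] act on. *)
have -> : (fun y => dotp (f y) (g y)) =
    \sum_(i < d) ((fun y => f y 0 i) * (fun y => g y 0 i)).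
  by apply/funext => y; rewrite fct_sumE.
rewrite -big_split; apply: is_derive_sum => i.
apply: is_derive_eq.
  exact: is_deriveM (is_derive_row_coord i f_df) (is_derive_row_coord i g_dg).
by rewrite /= [RHS]addrC [df 0 i * _]mulrC.
Qed.

Lemma is_derive_derive1 (R : realType) (V : normedModType R) (f : R -> V)
    (x : R) :
  derivable f x 1 -> is_derive x 1 f (f^`()%classic x).
Proof. by move=> ?; rewrite derive1E; exact: derivableP. Qed.

(** The difference quotients at [x + p] and at [x] are the same function of [h]. *)
Lemma derive1_periodic (R : realType) (V : normedModType R) (f : R -> V)
    (p : R) :
  periodic f p -> periodic (f^`()%classic) p.
Proof.
move=> f_periodic x; rewrite /derive1; congr (lim (_ @ 0^')).
by apply/funext => h; rewrite addrA !f_periodic.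
Qed.

Lemma is_derive_continuous (R : realType) (f df : R -> R) :
  (forall x : R, is_derive x 1 f (df x)) -> continuous f.
Proof.
move=> f_df x; apply/differentiable_continuous/derivable1_diffP.
by have [] := f_df x.
Qed.

Lemma Rintegral_derive (R : realType) (F f : R -> R) (a b : R) : a < b ->
  (forall x : R, is_derive x 1 F (f x)) -> continuous f ->
  \int[lebesgue_measure]_(x in `[a, b]) f x = F b - F a.
Proof.
move=> ab F_f f_cont; rewrite /Rintegral (@continuous_FTC2 _ _ F)//.
- exact: continuous_subspaceT.
(* [F] is differentiable on the whole line, hence continuous at [a] and [b]; this supplies the
   one-sided limits there. *)
- have F_cont := is_derive_continuous F_f.
  split=> [x _||].
  + by have [] := F_f x.
  + exact/cvg_at_right_filter/F_cont.
  + exact/cvg_at_left_filter/F_cont.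
- by move=> x _; rewrite derive1E; have [] := F_f x.
Qed.

(** Repeats the integrand of [F4] verbatim, so that facts about it apply to [F4] by conversion. *)
Definition F4_density (R : realType) (d : nat) (u : R -> 'rV[R]_d) (x : R) : R :=
  2^-1 * enorm (u^`()%classic x) ^+ 2 - 8^-1 * enorm (u x) ^+ 4.

Lemma F4_densityE (R : realType) (d : nat) (u : R -> 'rV[R]_d) (x : R) :
  F4_density u x = 2^-1 * dotp (u^`()%classic x) (u^`()%classic x)
    - 8^-1 * dotp (u x) (u x) ^+ 2.
Proof. by rewrite /F4_density sqr_enorm exprn4_enorm. Qed.

Lemma smooth_S1_is_derive (R : realType) (d : nat) (u : R -> 'rV[R]_d) (x : R) :
  smooth_S1 u -> is_derive x 1 u (u^`()%classic x).
Proof. by move=> [_ /(_ 0%N x)]; exact: is_derive_derive1. Qed.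

Lemma smooth_S1_derive1 (R : realType) (d : nat) (u : R -> 'rV[R]_d) :
  smooth_S1 u -> smooth_S1 (u^`()%classic).
Proof.
move=> [u_periodic u_derivable]; split; first exact: derive1_periodic.
by move=> k x; rewrite -derive1Sn.
Qed.

(** Serves both the fundamental theorem of calculus and, on the compact [[0, 1]], integrability. *)
Lemma continuous_F4_density (R : realType) (d : nat) (u : R -> 'rV[R]_d) :
  smooth_S1 u -> continuous (F4_density u).
Proof.
move=> u_smooth; have u'_smooth := smooth_S1_derive1 u_smooth.
have dotp_cont (f : R -> 'rV[R]_d) :
    smooth_S1 f -> continuous (fun x => dotp (f x) (f x)).
  move=> f_smooth; apply: is_derive_continuous => x.
  by apply: is_derive_dotp; exact: smooth_S1_is_derive.
rewrite (funext (F4_densityE u)).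
move=> x; apply: cvgB; first by apply: cvgMr; exact: dotp_cont.
by apply: cvgMr; apply: cvgM; exact: dotp_cont.
Qed.

Lemma is_derive_midpoint (R : realType) (d : nat) (a b : R -> 'rV[R]_d) (x : R)
    (da db : 'rV[R]_d) :
  is_derive x 1 a da -> is_derive x 1 b db ->
  is_derive x 1 (midpoint a b) (2^-1 *: (da + db)).
Proof. by move=> a_da b_db; apply: is_deriveZ; exact: is_deriveD. Qed.

Lemma derive1_midpoint (R : realType) (d : nat) (a b : R -> 'rV[R]_d) :
  smooth_S1 a -> smooth_S1 b ->
  (midpoint a b)^`()%classic = midpoint (a^`()%classic) (b^`()%classic).
Proof.
move=> a_smooth b_smooth; apply/funext => x; rewrite derive1E.
have a_da := smooth_S1_is_derive x a_smooth.
have b_db := smooth_S1_is_derive x b_smooth.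
by have [] := is_derive_midpoint a_da b_db.
Qed.

(** Pointwise algebra: values and derivatives at one point enter as independent vectors. The
    averaged coefficient in [v] is chosen so that [(|a|^2 + |b|^2)/4 * m . (b - a) = (|b|^4 -
    |a|^4)/8]; likewise [mx . (bx - ax) = (|bx|^2 - |ax|^2)/2]. *)
Lemma scheme_energy_identity (R : realType) (d : nat) (tau : R)
    (a b ax bx mxx v vx w : 'rV[R]_d) : tau != 0 ->
  let m := 2^-1 *: (a + b) in
  let mx := 2^-1 *: (ax + bx) in
  0 = tau^-1 *: (b - a) + vx + w ->
  0 = v - (4^-1 * (dotp a a + dotp b b)) *: m - mxx ->
  0 = w - dotp m m *: mx + dotp mx m *: m ->
  (2^-1 * dotp bx bx - 8^-1 * dotp b b ^+ 2)
    - (2^-1 * dotp ax ax - 8^-1 * dotp a a ^+ 2)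
  = dotp mxx (b - a) + dotp mx (bx - ax) + tau * dotp v vx
    + tau * (dotp m m * dotp mx mxx - dotp mx m * dotp m mxx).
Proof.
move=> tau0 m mx eq1 eq2 eq3.
(* Used below with [z = m], where the right-hand side vanishes, and with [z = mxx]. *)
have w_dot z : dotp w z = dotp m m * dotp mx z - dotp mx m * dotp m z.
  have -> : w = dotp m m *: mx - dotp mx m *: m.
    by apply/eqP; rewrite -subr_eq0 opprB addrA addrAC -eq3.
  by rewrite dotpDl dotpNl !dotpZl.
have vE : v = (4^-1 * (dotp a a + dotp b b)) *: m + mxx.
  by apply/eqP; rewrite -subr_eq0 opprD addrA -eq2.
have v_w : dotp v w = dotp m m * dotp mx mxx - dotp mx m * dotp m mxx.
  by rewrite dotpC vE dotpDr dotpZr !w_dot mulrC (mulrC (dotp m m)) subrr mul0r add0r.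
have deltaE : b - a = - tau *: (vx + w).
  apply/eqP; rewrite -subr_eq0 scaleNr opprK -[b - a]scale1r -(mulfV tau0).
  by rewrite -scalerA -scalerDr addrA -eq1 scaler0.
have v_delta : dotp v (b - a) = - tau * (dotp v vx + dotp v w).
  by rewrite deltaE dotpZr dotpDr.
(* This removes [vx] and makes the [tau * dotp v w] terms cancel; expanding [v . (b - a)] then
   leaves a polynomial identity in inner products. *)
have -> : tau * dotp v vx = - dotp v (b - a) - tau * dotp v w.
  by rewrite v_delta; ring.
rewrite -v_w vE !dotpE (dotpC b a) (dotpC bx ax) !(dotpC mxx).
by field.
Qed.

Lemma F4_scheme_step (R : realType) (d : nat) (tau : R)
    (a b v w : R -> 'rV[R]_d) : tau != 0 ->
  smooth_S1 a -> smooth_S1 b -> smooth_S1 v ->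
  scheme_step tau a b v w -> F4 b = F4 a.
Proof.
move=> tau0 a_smooth b_smooth v_smooth abvw.
have a'_smooth := smooth_S1_derive1 a_smooth.
have b'_smooth := smooth_S1_derive1 b_smooth.
pose m := midpoint a b.
pose m' := midpoint (a^`()%classic) (b^`()%classic).
pose m'' := m'^`()%classic.
have mE : (midpoint a b)^`()%classic = m' by exact: derive1_midpoint.
have m2E : (midpoint a b)^`(2)%classic = m'' by rewrite /m'' -mE.
have m_dm (x : R) : is_derive x 1 m (m' x).
  by apply: is_derive_midpoint; exact: smooth_S1_is_derive.
have m'_dm (x : R) : is_derive x 1 m' (m'' x).
  apply: is_derive_derive1.
  by have [] := is_derive_midpoint (smooth_S1_is_derive x a'_smooth)
    (smooth_S1_is_derive x b'_smooth).
(* From here on [m''] is an atom, known only through [m2E] and [m'_dm]. *)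
clearbody m''.
(* When the last bracket is differentiated, the two terms [2 (m . m') |m'|^2] cancel. What remains
   is twice the last bracket of [scheme_energy_identity], hence the factor [tau/2]. *)
pose G x := dotp (m' x) (b x - a x) + 2^-1 * tau * dotp (v x) (v x)
  + 2^-1 * tau * (dotp (m x) (m x) * dotp (m' x) (m' x) - dotp (m' x) (m x) ^+ 2).
have G_periodic : periodic G 1.
  have [aP _] := a_smooth; have [bP _] := b_smooth; have [vP _] := v_smooth.
  have [a'P _] := a'_smooth; have [b'P _] := b'_smooth.
  by move=> x; rewrite /G /m /m' /midpoint aP bP vP a'P b'P.
have G_dG (x : R) : is_derive x 1 G (F4_density b x - F4_density a x).
  have [eq1 eq2 eq3] := abvw x.
  move: eq2 eq3; rewrite !sqr_enorm mE m2E => eq2 eq3.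
  rewrite !F4_densityE (scheme_energy_identity tau0 eq1 eq2 eq3).
  have ba_d := is_deriveB (smooth_S1_is_derive x b_smooth)
    (smooth_S1_is_derive x a_smooth).
  have vd := smooth_S1_is_derive x v_smooth.
  have d1 := is_derive_dotp (m'_dm x) ba_d.
  have d2 := is_deriveZ (2^-1 * tau) (is_derive_dotp vd vd).
  have mm := is_derive_dotp (m_dm x) (m_dm x).
  have m'm' := is_derive_dotp (m'_dm x) (m'_dm x).
  have m'm := is_derive_dotp (m'_dm x) (m_dm x).
  have d3 := is_deriveZ (2^-1 * tau)
    (is_deriveB (is_deriveM mm m'm') (is_deriveX 2 m'm)).
  apply: is_derive_eq (is_deriveD (is_deriveD d1 d2) d3) _.
  rewrite -[2^-1 *: (a x + b x)]/(m x).
  rewrite -[2^-1 *: (_ + _)]/(m' x) expr1.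
  rewrite -[(b - a) x]/(b x - a x).
  rewrite (dotpC (v^`()%classic x)) !(dotpC _ (m'' x)) (dotpC (m x) (m' x)).
  (* The derivative rules produce [*:] on [R] as a module over itself; [field] needs the ring
     product. *)
  have scaleE (k y : R) : k *: (y : R^o) = k * y by [].
  rewrite !scaleE.
  by field.
have Ge_cont : continuous (fun x => F4_density b x - F4_density a x).
  by move=> x; apply: cvgB; exact: continuous_F4_density.
(* Integrability lets the difference of the two energies be written as one integral. *)
have itg u : smooth_S1 u ->
    lebesgue_measure.-integrable `[0, 1] (EFin \o F4_density u).
  move=> u_smooth; apply: continuous_compact_integrable.
    exact: segment_compact.
  by apply: continuous_subspaceT; exact: continuous_F4_density.
apply/eqP; rewrite -subr_eq0 /F4 -RintegralB//; [|exact: itg|exact: itg].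
rewrite (@Rintegral_derive _ G)//.
(* The endpoint [1] is read as [0 + 1], so periodicity gives [G 1 = G 0]. *)
by rewrite -[X in G X - _]add0r G_periodic subrr.
Qed.

Theorem theorem3p2 (R : realType) (d : nat) (d_ge1 : (1 <= d)%N)
    (N : nat) (N_ge1 : (1 <= N)%N) (T : R) (t : nat -> R)
    (t_0 : t 0%N = 0) (t_N : t N = T)
    (t_incr : forall n : nat, (n < N)%N -> t n < t n.+1)
    (u : nat -> R -> 'rV[R]_d)
    (u_smooth : forall n : nat, (n <= N)%N -> smooth_S1 (u n))
    (u_scheme : forall n : nat, (n < N)%N ->
       exists v w : R -> 'rV[R]_d,
         [/\ smooth_S1 v, smooth_S1 w
           & scheme_step (t n.+1 - t n) (u n) (u n.+1) v w]) :
  forall n : nat, (n <= N)%N -> F4 (u n) = F4 (u 0%N).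
Proof.
(* [n.+1 <= N] is [n < N] by definition, so [n_lt] serves for both the smoothness of [u n.+1] and
   the step from [n]. *)
elim=> [//|n IHn] n_lt; rewrite -(IHn (ltnW n_lt)).
have [v [w [v_smooth _ step]]] := u_scheme n n_lt.
have tau_neq0 : t n.+1 - t n != 0 by rewrite subr_eq0 gt_eqF// t_incr.
have un_smooth := u_smooth n (ltnW n_lt).
exact: F4_scheme_step tau_neq0 un_smooth (u_smooth n.+1 n_lt) v_smooth step.
Qed.
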